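(* Let $G=\prod_{n=1}^\infty G_n$ be a product of locally compact, $\sigma$-compact groups $G_n$ and let $H$ be a closed normal subgroup of $G$. If $\mathcal E_L(G)\upharpoonright H$ is metrisable, then $$\mathcal E_q(G/H)=\mathcal E_L(G/H)=\mathcal E_{\rm Haus}(G/H).$$
   Context: A coarse structure on a set $X$ is an ideal $\mathcal E$ of subsets of $X\times X$ (closed under subsets and finite unions) containing the diagonal and closed under transposition and composition $E\circ F=\{(x,z): \exists y\ (x,y)\in E,\ (y,z)\in F\}$. A pseudometric $d$ on $X$ induces $\mathcal E_d(X)=\{E\subseteq X\times X:\sup_{(x,y)\in E}d(x,y)<\infty\}$; a coarse structure is metrisable if it equals $\mathcal E_d(X)$ for some metric $d$. For $Y\subseteq X$, the restriction is $\mathcal E\upharpoonright Y=\{E\in\mathcal E: E\subseteq Y\times Y\}$, a coarse structure on $Y$. A map $\phi\colon(X,\mathcal E)\to(Y,\mathcal F)$ is controlled if $(\phi\times\phi)[E]\in\mathcal F$ for all $E\in\mathcal E$. For a topological group $G$, the left coarse structure is $\mathcal E_L(G)=\bigcap_d\mathcal E_d(G)$, where $d$ ranges over all continuous left-invariant pseudometrics on $G$. If $H$ is a closed normal subgroup with quotient map $\pi\colon G\to G/H$, $\mathcal E_L(G/H)$ is the left coarse structure of the topological quotient group $G/H$; $\mathcal E_q(G/H)$ is the smallest coarse structure on $G/H$ making $\pi\colon (G,\mathcal E_L(G))\to G/H$ controlled; and $\mathcal E_{\rm Haus}(G/H)=\bigcap_d\mathcal E_{d_{\rm Haus}}(G/H)$,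 where $d$ ranges over the continuous left-invariant pseudometrics on $G$ and $d_{\rm Haus}$ is the Hausdorff distance between cosets with respect to $d$, which satisfies $d_{\rm Haus}(Hg,Hf)=\inf_{h\in H}d(hg,f)$. The product $\prod_{n}G_n$ carries the product topology. *)

(* Defs.v *)
From HB Require Import structures.
From mathcomp Require Import all_boot all_order all_algebra.
From mathcomp Require Import generic_quotient.
From mathcomp Require Import all_classical all_reals all_analysis.

Set Implicit Arguments.
Unset Strict Implicit.
Unset Printing Implicit Defensive.

Import Order.TTheory GRing.Theory Num.Theory.
Import numFieldNormedType.Exports.

Local Open Scope classical_set_scope.
Local Open Scope ring_scope.

(* No separation axiom is part of the notion of a topological group. *)
HB.mixin Record isTopologicalGroup G of Group G & Topological G := {
  mulg_continuous : continuous (fun p : G * G => (p.1 * p.2)%g);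
  invg_continuous : continuous (fun x : G => (x^-1)%g)
}.

#[short(type="topologicalGroupType")]
HB.structure Definition TopologicalGroup :=
  {G of isTopologicalGroup G & Group G & Topological G}.

Definition sigma_compact (T : topologicalType) :=
  exists K : nat -> set T, (forall n, compact (K n)) /\ \bigcup_n K n = setT.

Section prod_group.
Context {I : Type} (G_ : I -> topologicalGroupType).
Local Notation P := (prod_topology G_).
Implicit Types x y z : P.

Let one : P := fun=> 1%g.
Let mul x y : P := fun i => (x i * y i)%g.
Let inv x : P := fun i => (x i)^-1%g.

Let mulA : associative mul.
Proof. by move=> x y z; apply: functional_extensionality_dep => i; exact: mulgA. Qed.
Let mul1 : left_id one mul.
Proof. by move=> x; apply: functional_extensionality_dep => i; exact: mul1g. Qed.
Let mulr1 : right_id one mul.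
Proof. by move=> x; apply: functional_extensionality_dep => i; exact: mulg1. Qed.
Let mulV : left_inverse one inv mul.
Proof. by move=> x; apply: functional_extensionality_dep => i; exact: mulVg. Qed.
Let mulrV : right_inverse one inv mul.
Proof. by move=> x; apply: functional_extensionality_dep => i; exact: mulgV. Qed.

HB.instance Definition _ := isGroup.Build P mulA mul1 mulr1 mulV mulrV.

Let prod_cvg (F : set_system P) (p : P) : Filter F ->
  (forall i, (fun x : P => x i) @ F --> p i) -> F --> p.
Proof.
move=> FF h; apply/cvg_sup => i U /= [B [[W oW <-]] Wp WU].
apply: (filterS WU); apply: (h i W); exact: open_nbhs_nbhs.
Qed.

Let proj_cts i : continuous (fun x : P => x i).
Proof.
move=> x; have /cvg_sup/(_ i) h : x --> x by exact: cvg_id.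
exact: (cvg_comp _ _ h (@initial_continuous _ _ (fun f : P => f i) x)).
Qed.

Let mul_cts : continuous (fun p : P * P => (p.1 * p.2)%g).
Proof.
move=> p; apply: prod_cvg => i.
have h1 : (fun q : P * P => q.1 i) @ p --> p.1 i.
  apply: (@cvg_comp _ _ _ (fun q : P * P => q.1) (fun x : P => x i) _ (nbhs p.1)).
    exact: cvg_fst.
  exact: proj_cts.
have h2 : (fun q : P * P => q.2 i) @ p --> p.2 i.
  apply: (@cvg_comp _ _ _ (fun q : P * P => q.2) (fun x : P => x i) _ (nbhs p.2)).
    exact: cvg_snd.
  exact: proj_cts.
exact: (cvg_comp _ _ (cvg_pair h1 h2) (@mulg_continuous _ (p.1 i, p.2 i))).
Qed.

Let inv_cts : continuous (fun x : P => (x^-1)%g).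
Proof.
move=> x; have FF := fmap_filter (fun x : P => (x^-1)%g) (nbhs_filter x).
apply: (@prod_cvg _ _ FF) => i.
exact: (cvg_comp _ _ (@proj_cts i x) (@invg_continuous _ (x i))).
Qed.

HB.instance Definition _ := isTopologicalGroup.Build P mul_cts inv_cts.

End prod_group.

Record normal_subgroup (G : groupType) (H : set G) : Prop := NormalSubgroup {
  normal1 : H 1%g;
  normalM : forall x y, H x -> H y -> H (x * y)%g;
  normalV : forall x, H x -> H (x^-1)%g;
  normalJ : forall x g, H x -> H (g^-1 * x * g)%g
}.

Section quotient_group.
Local Open Scope quotient_scope.
Context (G : topologicalGroupType) (H : set G) (nH : normal_subgroup H).

(* Hx = Hy *)
Definition right_coset_rel (x y : G) : bool := `[< H (x * y^-1)%g >].

Lemma right_coset_rel_equiv : equiv_class_of right_coset_rel.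
Proof.
split=> [x|x y|y x z].
- by apply/asboolP; rewrite mulgV; exact: normal1.
- by apply/asboolP/asboolP => /(normalV nH); rewrite invgM invgK.
- move=> /asboolP xy /asboolP yz; apply/asboolP.
  by have := normalM nH xy yz; rewrite mulgA mulgVK.
Qed.

Definition right_coset_equiv : equiv_rel G :=
  EquivRelPack right_coset_rel_equiv.

Definition quotient_group : Type :=
  quotient_topology {eq_quot right_coset_equiv}.

HB.instance Definition _ := Topological.on quotient_group.
HB.instance Definition _ := Quotient.on quotient_group.

Definition quotient_pi : G -> quotient_group := \pi_quotient_group.
Local Notation Q := quotient_group.
Local Notation pi := quotient_pi.
Implicit Types (x y g : G) (q : Q).

Lemma quotient_piP x y : pi x = pi y <-> H (x * y^-1)%g.
Proof.
split=> [/eqmodP xy|Hxy]; first exact/asboolP.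
by apply/eqmodP; exact/asboolP.
Qed.

Lemma quotient_reprK : cancel repr pi.
Proof. exact: reprK. Qed.

Lemma quotient_pi_fiber g :
  pi @^-1` [set pi g] = [set (h * g)%g | h in H].
Proof.
apply/seteqP; split=> x /= => [/quotient_piP Hx|[h Hh <-]].
  by exists (x * g^-1)%g => //; rewrite mulgVK.
by apply/quotient_piP; rewrite mulgK.
Qed.

Let one : Q := pi 1%g.
Let mul (p q : Q) : Q := pi (repr p * repr q)%g.
Let inv (q : Q) : Q := pi (repr q)^-1%g.

Let piM x y : mul (pi x) (pi y) = pi (x * y)%g.
Proof.
rewrite /mul.
have [a Ha ->] : exists2 a, H a & repr (pi x) = (a * x)%g.
  have /quotient_piP hx := quotient_reprK (pi x).
  by exists (repr (pi x) * x^-1)%g => //; rewrite mulgVK.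
have [b Hb ->] : exists2 b, H b & repr (pi y) = (b * y)%g.
  have /quotient_piP hy := quotient_reprK (pi y).
  by exists (repr (pi y) * y^-1)%g => //; rewrite mulgVK.
apply/quotient_piP.
have -> : ((a * x) * (b * y) * (x * y)^-1 = a * (x^-1^-1 * b * x^-1))%g.
  by rewrite invgK invgM !mulgA mulgK.
by apply: (normalM nH) => //; exact: normalJ.
Qed.

Let piV x : inv (pi x) = pi (x^-1)%g.
Proof.
have [a Ha] : exists2 a, H a & repr (pi x) = (a * x)%g.
  have /quotient_piP hx := quotient_reprK (pi x).
  by exists (repr (pi x) * x^-1)%g => //; rewrite mulgVK.
rewrite /inv => ->; apply/quotient_piP; rewrite invgK invgM.
by apply: (normalJ nH); exact: normalV.
Qed.

Let mulA : associative mul.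
Proof.
move=> p q r; rewrite -(quotient_reprK p) -(quotient_reprK q).
by rewrite -(quotient_reprK r) !piM mulgA.
Qed.
Let mul1 : left_id one mul.
Proof. by move=> p; rewrite -(quotient_reprK p) piM mul1g. Qed.
Let mulr1 : right_id one mul.
Proof. by move=> p; rewrite -(quotient_reprK p) piM mulg1. Qed.
Let mulV : left_inverse one inv mul.
Proof. by move=> p; rewrite -(quotient_reprK p) piV piM mulVg. Qed.
Let mulrV : right_inverse one inv mul.
Proof. by move=> p; rewrite -(quotient_reprK p) piV piM mulgV. Qed.

HB.instance Definition _ := isGroup.Build Q mulA mul1 mulr1 mulV mulrV.

Lemma quotient_piM x y : pi (x * y)%g = (pi x * pi y)%g.
Proof. by rewrite -piM. Qed.

Lemma quotient_piV x : pi (x^-1)%g = ((pi x)^-1)%g.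
Proof. by rewrite -piV. Qed.

Lemma quotient_pi_continuous : continuous pi.
Proof. exact: pi_continuous. Qed.

Lemma quotient_pi_open (A : set G) : open A -> open (pi @` A).
Proof.
move=> oA; change (open (pi @^-1` (pi @` A))).
have -> : pi @^-1` (pi @` A) = \bigcup_(h in H) ((fun x => h * x)%g @^-1` A).
  apply/seteqP; split=> x /= => [[a Aa] /quotient_piP Hax|[h Hh Ahx]].
    by exists (a * x^-1)%g => //=; rewrite mulgVK.
  by exists (h * x)%g => //; apply/quotient_piP; rewrite mulgK.
apply: bigcup_open => h _; apply: open_comp => // x _.
have c1 : (fun=> h) @ x --> h by exact: cvg_cst.
exact: (cvg_comp _ _ (cvg_pair c1 (@cvg_id _ (nbhs x))) (@mulg_continuous _ (h, x))).
Qed.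

Let nbhs_pi (x : G) (A : set G) : nbhs x A -> nbhs (pi x) (pi @` A).
Proof.
rewrite nbhsE => -[W [oW Wx] WA].
apply: (@filterS _ _ _ (pi @` W)); first exact: image_subset.
by apply: open_nbhs_nbhs; split; [exact: quotient_pi_open|exists x].
Qed.

Let mul_cts : continuous (fun p : Q * Q => (p.1 * p.2)%g).
Proof.
move=> [p q] U /=; rewrite -(quotient_reprK p) -(quotient_reprK q).
rewrite -quotient_piM => /quotient_pi_continuous.
move=> /(mulg_continuous (repr p, repr q)) [[A B] /= [nA nB] AB].
exists (pi @` A, pi @` B); first by split; exact: nbhs_pi.
move=> [_ _] /= [[a Aa <-] [b Bb <-]]; rewrite -quotient_piM.
exact: (AB (a, b)).
Qed.

Let inv_cts : continuous (fun q : Q => (q^-1)%g).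
Proof.
move=> q U; rewrite -(quotient_reprK q) -quotient_piV.
move=> /quotient_pi_continuous /invg_continuous/nbhs_pi; apply: filterS.
by move=> _ [x /= Ux <-]; rewrite -quotient_piV.
Qed.

HB.instance Definition _ := isTopologicalGroup.Build Q mul_cts inv_cts.

End quotient_group.

Section coarse.
Local Open Scope relation_scope.
Context {X Y : Type}.

Record coarse_structure (E : set (set (X * X))) : Prop := CoarseStructure {
  coarse_diagonal : E diagonal;
  coarse_sub : forall A B, A `<=` B -> E B -> E A;
  coarseU : forall A B, E A -> E B -> E (A `|` B);
  coarseV : forall A, E A -> E A^-1;
  coarse_comp : forall A B, E A -> E B -> E (B \; A) (* [\;] applies A first *)
}.

Definition controlled (E : set (set (X * X))) (F : set (set (Y * Y)))
    (phi : X -> Y) :=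
  forall A, E A -> F [set (phi xy.1, phi xy.2) | xy in A].

Definition coarse_restrict (E : set (set (X * X))) (Z : set X) :=
  [set A | E A /\ A `<=` Z `*` Z].

End coarse.

Definition coarse_pushforward (X Y : Type) (E : set (set (X * X)))
    (phi : X -> Y) : set (set (Y * Y)) :=
  \bigcap_(F in [set F | coarse_structure F /\ controlled E F phi]) F.

Lemma coarse_pushforward_least (X Y : Type) (E : set (set (X * X)))
    (phi : X -> Y) :
  [/\ coarse_structure (coarse_pushforward E phi),
      controlled E (coarse_pushforward E phi) phi &
      forall F, coarse_structure F -> controlled E F phi ->
        coarse_pushforward E phi `<=` F].
Proof.
split=> [|A EA F [_]|F cF cE A]; [|exact|exact].
split=> [F [cF _]|A B AB EB F cF|A B EA EB F cF|A EA F cF|A B EA EB F cF].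
- exact: coarse_diagonal.
- by apply: (coarse_sub cF.1 AB); exact: EB.
- by apply: (coarseU cF.1); [exact: EA|exact: EB].
- by apply: (coarseV cF.1); exact: EA.
- by apply: (coarse_comp cF.1); [exact: EA|exact: EB].
Qed.

Section metric.
Context {R : realType} {X : Type}.
Implicit Types (d : X -> X -> R) (Z A B : set X).

Record pseudometric_on Z d : Prop := PseudometricOn {
  pseudometric_ge0 : forall x y, Z x -> Z y -> 0 <= d x y;
  pseudometric_refl : forall x, Z x -> d x x = 0;
  pseudometric_sym : forall x y, Z x -> Z y -> d x y = d y x;
  pseudometric_triangle : forall x y z,
    Z x -> Z y -> Z z -> d x z <= d x y + d y z
}.

Definition metric_on Z d :=
  pseudometric_on Z d /\ forall x y, Z x -> Z y -> d x y = 0 -> x = y.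

(* sup_E d < oo; the sup of the empty set counts as finite *)
Definition bounded_coarse d : set (set (X * X)) :=
  [set E | has_ubound [set d xy.1 xy.2 | xy in E]].

Lemma bounded_coarse_structure d :
  pseudometric_on setT d -> coarse_structure (bounded_coarse d).
Proof.
move=> [_ d0 dC dT]; split.
- by exists 0 => _ [[x y] /diagonalP -> <-] /=; rewrite d0.
- by move=> A B AB [M BM]; exists M => _ [xy Axy <-]; apply: BM; exists xy; auto.
- move=> A B [M AM] [N BN]; exists (Num.max M N) => _ [xy [h|h] <-].
    by rewrite le_max AM //; exists xy.
  by rewrite le_max BN ?orbT //; exists xy.
- move=> A [M AM]; exists M => _ [[x y] /= Ayx <-].
  by rewrite /= (dC x y) //; apply: AM; exists (y, x).
- move=> A B [M AM] [N BN]; exists (M + N) => _ [[x z] /= [y Axy Byz] <-].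
  apply: (le_trans (dT x y z I I I)); apply: lerD.
    by apply: AM; exists (x, y).
  by apply: BN; exists (y, z).
Qed.

Definition hausdorff_dist d A B : R :=
  Num.max (sup [set inf [set d a b | b in B] | a in A])
          (sup [set inf [set d a b | a in A] | b in B]).

End metric.

(* [metrisable_on R Z E]: E, a coarse structure on the subset Z of X, is the one
   induced by a metric on Z; the values of d outside Z are irrelevant. *)
Definition metrisable_on (R : realType) (X : Type) (Z : set X)
    (E : set (set (X * X))) :=
  exists d : X -> X -> R,
    metric_on Z d /\ E = coarse_restrict (bounded_coarse d) Z.

Arguments metrisable_on R {X} Z E.

Record continuous_left_invariant_pseudometric (R : realType)
    (G : topologicalGroupType) (d : G -> G -> R) : Prop := ContLeftInv {
  clip_pseudometric : pseudometric_on setT d;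
  clip_left_invariant : forall g x y, d (g * x)%g (g * y)%g = d x y;
  clip_continuous : continuous (fun xy : G * G => d xy.1 xy.2)
}.

Definition left_coarse (R : realType) (G : topologicalGroupType) :
    set (set (G * G)) :=
  \bigcap_(d in @continuous_left_invariant_pseudometric R G) bounded_coarse d.

Arguments left_coarse R G : clear implicits.

Lemma left_coarse_structure (R : realType) (G : topologicalGroupType) :
  coarse_structure (left_coarse R G).
Proof.
have cd (d : G -> G -> R) : continuous_left_invariant_pseudometric d ->
    coarse_structure (bounded_coarse d).
  by move=> [pd _ _]; exact: bounded_coarse_structure.
split=> [d /cd cs|A B AB EB d pd|A B EA EB d pd|A EA d pd|A B EA EB d pd].
- exact: coarse_diagonal cs.
- exact: (coarse_sub (cd _ pd) AB (EB _ pd)).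
- exact: (coarseU (cd _ pd) (EA _ pd) (EB _ pd)).
- exact: (coarseV (cd _ pd) (EA _ pd)).
- exact: (coarse_comp (cd _ pd) (EA _ pd) (EB _ pd)).
Qed.

Section quotient_coarse.
Context (R : realType) (G : topologicalGroupType) (H : set G).
Context (nH : normal_subgroup H).
Local Notation Q := (quotient_group nH).
Local Notation pi := (quotient_pi nH).

Definition quotient_coarse : set (set (Q * Q)) :=
  coarse_pushforward (left_coarse R G) pi.

(* The points of G/H, regarded as the cosets they are. *)
Definition coset_hausdorff (d : G -> G -> R) (p q : Q) : R :=
  hausdorff_dist d (pi @^-1` [set p]) (pi @^-1` [set q]).

Definition hausdorff_coarse : set (set (Q * Q)) :=
  \bigcap_(d in @continuous_left_invariant_pseudometric R G)
    bounded_coarse (coset_hausdorff d).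

Lemma coset_hausdorffE (d : G -> G -> R) (g f : G) :
  continuous_left_invariant_pseudometric d ->
  coset_hausdorff d (pi g) (pi f) = inf [set d (h * g)%g f | h in H].
Proof.
move=> [[_ _ dC _] dL _]; rewrite /coset_hausdorff !quotient_pi_fiber.
set A := [set d _ _ | _ in _].
suff [e1 e2] : (forall h, H h ->
    [set d (h * g)%g b | b in [set (k * f)%g | k in H]] = A) /\
    (forall h, H h -> [set d a (h * f)%g | a in [set (k * g)%g | k in H]] = A).
  rewrite /hausdorff_dist.
  rewrite (_ : [set _ | _ in _] = [set inf A]); last first.
    apply/seteqP; split=> [_ [_ [h Hh <-] <-] /=|_ ->]; first by rewrite e1.
    by exists g; [exists 1%g; [exact: normal1|rewrite mul1g]|
      rewrite -(e1 1%g) ?mul1g //; exact: normal1].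
  rewrite (_ : [set _ | _ in _] = [set inf A]); last first.
    apply/seteqP; split=> [_ [_ [h Hh <-] <-] /=|_ ->]; first by rewrite e2.
    by exists f; [exists 1%g; [exact: normal1|rewrite mul1g]|
      rewrite -(e2 1%g) ?mul1g //; exact: normal1].
  by rewrite sup1 maxxx.
split=> h Hh; apply/seteqP; split=> [_ [_ [k Hk <-] <-]|_ [k Hk <-]].
- exists (k^-1 * h)%g; first by apply: (normalM nH) => //; exact: normalV.
  by rewrite -(dL k) !mulgA mulgV mul1g.
- exists ((h * k^-1) * f)%g.
    by exists (h * k^-1)%g => //; apply: (normalM nH) => //; exact: normalV.
  by rewrite -(dL (k * h^-1)%g) !mulgA !mulgVK mulgV mul1g.
- exists (h^-1 * k)%g; first by apply: (normalM nH) => //; exact: normalV.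
  by rewrite -(dL h) !mulgA mulgV mul1g.
- exists ((h * k) * g)%g; first by exists (h * k)%g => //; exact: (normalM nH).
  by rewrite -(dL h^-1%g) !mulgA mulVg !mul1g.
Qed.

End quotient_coarse.

Arguments quotient_coarse R {G H} nH.
Arguments hausdorff_coarse R {G H} nH.

(* Main.v *)
Require Import Defs.
From HB Require Import structures.
From mathcomp Require Import all_boot all_order all_algebra zify lra.
From mathcomp Require Import all_classical all_reals all_analysis.

Set Implicit Arguments.
Unset Strict Implicit.
Unset Printing Implicit Defensive.
Import Order.TTheory GRing.Theory Num.Theory.
Import numFieldNormedType.Exports.

Local Open Scope classical_set_scope.
Local Open Scope ring_scope.

(* Let D_n be a proper continuous left-invariant pseudometric on G_n
   (Birkhoff-Kakutani at all scales 2^i, i : int), pulled back to G. By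
   Tychonoff, a set belongs to E_L(G) as soon as every D_n is bounded on it.
   Metrisability of E_L(G)|H gives an N such that a subset of H bounded in its
   first N coordinates is bounded in all of them. Now let E be bounded for all
   Hausdorff pseudometrics. For (Hg, Hf) in E choose h in H with hg close to f in
   the first N coordinates; for each m there is also k in H with kg close to f in
   coordinates up to m. The element (hg)^-1(kg) of H is bounded in the first N
   coordinates, hence in the m-th one, so the single choice hg is at bounded D_m
   distance from f for every m, and E lifts to a member of E_L(G).
   E_L(G/H) = E_Haus(G/H) and E_q(G/H) <= E_L(G/H) hold in any topological group.
*)

(** * Continuity of left-invariant pseudometrics *)

Local Notation clip := continuous_left_invariant_pseudometric.

(** Left translation carries continuity at the identity to every point, and the triangle inequality
    turns it into joint continuity. *)
Lemma left_invariant_clip (R : realType) (G : topologicalGroupType)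
    (d : G -> G -> R) :
  pseudometric_on setT d ->
  (forall g x y, d (g * x)%g (g * y)%g = d x y) ->
  (forall e, 0 < e -> nbhs (1%g : G) [set x | d 1%g x < e]) ->
  clip d.
Proof.
move=> dp dL d1; split=> // -[x y].
have nb (z : G) e : 0 < e -> nbhs z [set t | d z t < e].
  move=> /d1; rewrite -(mulVg z) => n1.
  have c : (fun t => (z^-1 * t)%g) @ z --> (z^-1 * z)%g.
    have c1 : (fun=> (z^-1)%g) @ z --> (z^-1)%g by exact: cvg_cst.
    exact: (cvg_comp _ _ (cvg_pair c1 (@cvg_id _ (nbhs z)))
      (@mulg_continuous _ (z^-1, z)%g)).
  apply: (@filterS _ (nbhs z) _ _ _ _ (c _ n1)) => t /=.
  by rewrite mulVg -{1}(mulVg z) dL.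
apply/cvgrPdist_lt => e e0 /=.
have e2 : 0 < e / 2 by lra.
exists ([set t | d x t < e / 2], [set t | d y t < e / 2]) => /=.
  by split; exact: nb.
move=> [a b] /= [xa yb].
case: dp => d0 _ dC dT.
have := dT x a y I I I; have := dT a b y I I I.
have := dT a x b I I I; have := dT x y b I I I.
rewrite (dC a x) // (dC b y) // => h1 h2 h3 h4.
rewrite ltr_norml; apply/andP; split; lra.
Qed.

(** * Chains in a group with a weak triangle inequality *)

Section chain.
Context (R : realType) (G : groupType) (f : G -> R).
Hypothesis f0 : forall x, 0 <= f x.
Hypothesis f1 : f 1%g = 0.
Hypothesis fM : forall x y z r,
  f x <= r -> f y <= r -> f z <= r -> f (x * y * z)%g <= 2 * r.

(** The entry [x] is the first one at which the running sum exceeds [t], or the last entry of [s] if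
    that never happens; the maximum with 0 serves this second case. *)
Lemma split_sum (s : seq G) (t : R) : s != [::] -> 0 <= t ->
  exists s1 x s2, [/\ s = s1 ++ x :: s2, \sum_(v <- s1) f v <= t &
    \sum_(v <- s2) f v <= Num.max 0 (\sum_(v <- s) f v - t)].
Proof.
elim: s t => // y s IH t _ t0.
have [->|sn0] := eqVneq s [::].
  by exists [::], y, [::]; rewrite !big_nil le_max lexx.
have [ty|yt] := ltP t (f y).
  exists [::], y, s; split=> //; first by rewrite big_nil.
  by rewrite le_max big_cons; apply/orP; right; lra.
have [|s1 [x [s2 [-> h1 h2]]]] := IH (t - f y) sn0; first lra.
exists (y :: s1), x, s2; split=> //; first by rewrite big_cons; lra.
by apply: (le_trans h2); rewrite big_cons; apply: le_max2 => //; lra.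
Qed.

(* Frink's chain lemma: cut the product at the half of the sum. *)
Lemma chain_le (s : seq G) :
  f (\prod_(v <- s) v)%g <= 2 * \sum_(v <- s) f v.
Proof.
have S0 t : 0 <= \sum_(v <- t) f v by apply: sumr_ge0.
have [n] := ubnP (size s); elim: n s => // n IH s sn.
have [->|sn0] := eqVneq s [::]; first by rewrite !big_nil f1 mulr0.
have [|s1 [x [s2 [es h1 h2]]]] := @split_sum s ((\sum_(v <- s) f v) / 2) sn0.
  by have := S0 s; lra.
have {}h2 : \sum_(v <- s2) f v <= (\sum_(v <- s) f v) / 2.
  by apply: (le_trans h2); rewrite ge_max; have := S0 s; lra.
rewrite es in sn; rewrite {1}es big_cat big_cons /= mulgA.
move: sn; rewrite size_cat /= addnS ltnS => sn.
(* Here [r] is the whole sum. Each outer piece has at most half of it, so by induction its product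
   has value at most [r]; the middle entry is a single summand. *)
apply: fM.
- apply: le_trans (IH _ _) _; last lra.
  exact: leq_ltn_trans (leq_addr _ _) sn.
- by rewrite es big_cat big_cons /=; have := S0 s1; have := S0 s2; lra.
- apply: le_trans (IH _ _) _; last lra.
  exact: leq_ltn_trans (leq_addl _ _) sn.
Qed.

End chain.

(** * The Birkhoff-Kakutani construction over all integer scales *)

Section birkhoff_kakutani.
(* [S i] plays the role of the ball of radius 2^i. *)
Context (R : realType) (G : topologicalGroupType) (S : int -> set G).
Hypothesis S_nbhs : forall i, nbhs (1%g : G) (S i).
Hypothesis SV : forall i x, S i x -> S i (x^-1)%g.
Hypothesis S3 : forall i x y z,
  S i x -> S i y -> S i z -> S (i + 1) (x * y * z)%g.
Hypothesis S_cover : forall x, exists i, S i x.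

Let S1 i : S i 1%g. Proof. exact: nbhs_singleton. Qed.

Lemma scale_nested (i j : int) : i <= j -> S i `<=` S j.
Proof.
move=> ij; have -> : j = i + `|j - i|%N by rewrite gez0_abs; lia.
elim: `|j - i|%N => [|n IH] x Six; first by rewrite addr0.
rewrite -addn1 PoszD addrA -(mulg1 x) -(mulg1 x).
by apply: S3 => //; exact: IH.
Qed.

(** This gauge obeys only the weak triangle inequality [fM]. Passing to infima over chains, in
    [len], makes it subadditive at the cost of a factor 2. *)
Let f (x : G) : R := inf [set 2 ^ i | i in [set i | S i x]].

Let f_lb x : has_lbound [set (2 : R) ^ i | i in [set i | S i x]].
Proof. by exists 0 => _ [i _ <-]; rewrite exprz_ge0. Qed.

Let f_inf x : has_inf [set (2 : R) ^ i | i in [set i | S i x]].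
Proof. by split=> //; have [i Six] := S_cover x; exists (2 ^ i); exists i. Qed.

Let f_ge0 x : 0 <= f x.
Proof.
apply: lb_le_inf; first by have [] := f_inf x.
by move=> _ [i _ <-]; rewrite exprz_ge0.
Qed.

Let f_le i x : S i x -> f x <= 2 ^ i.
Proof. by move=> Six; apply: ge_inf => //; exists i. Qed.

Let f_lt x r : f x < r -> exists2 i, (2 : R) ^ i < r & S i x.
Proof.
move=> fr; have e0 : 0 < r - f x by rewrite subr_gt0.
have [_ [i Six <-]] := inf_adherent e0 (f_inf x).
by rewrite addrC subrK; exists i.
Qed.

Lemma exprz2_small (e : R) : 0 < e -> exists i : int, (2 : R) ^ i < e.
Proof.
move=> e0; exists (- (Posz (Num.bound e^-1))).
rewrite -invr_expz invf_plt ?posrE ?exprz_gt0 //.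
exact: (@upper_nthrootP _ _ (Num.bound e^-1)).
Qed.

Let f1 : f 1%g = 0.
Proof.
apply/eqP; rewrite eq_le f_ge0 andbT; apply/ler_addgt0Pr => e e0.
have [i ie] := exprz2_small e0.
by rewrite add0r; apply: le_trans (ltW ie); exact: f_le.
Qed.

Let fV x : f (x^-1)%g = f x.
Proof.
rewrite /f; suff -> : [set i | S i (x^-1)%g] = [set i | S i x] by [].
by apply/seteqP; split=> i /= /SV //; rewrite invgK.
Qed.

(** All three factors lie in the largest of their scales, and [S3] then moves up one scale, which
    doubles the radius. The slack [e / 2] is there because the infimum need not be attained. *)
Let fM x y z r : f x <= r -> f y <= r -> f z <= r -> f (x * y * z)%g <= 2 * r.
Proof.
move=> fx fy fz; apply/ler_addgt0Pr => e e0.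
have [|i ir Si] := @f_lt x (r + e / 2); first lra.
have [|j jr Sj] := @f_lt y (r + e / 2); first lra.
have [|k kr Sk] := @f_lt z (r + e / 2); first lra.
pose m := Num.max i (Num.max j k).
have mr : (2 : R) ^ m < r + e / 2.
  by rewrite /m /Num.max; case: ifP => _ //; case: ifP.
have : S (m + 1) (x * y * z)%g.
  apply: S3; [move: Si|move: Sj|move: Sk]; apply: scale_nested;
    by rewrite /m !le_max lexx ?orbT.
move=> /f_le; rewrite expfzDr ?pnatr_eq0 // expr1z; lra.
Qed.

Let chains x := [set \sum_(v <- s) f v | s in
  [set s : seq G | (\prod_(v <- s) v)%g = x]].
Let len (x : G) : R := inf (chains x).

Let len_lb x : has_lbound (chains x).
Proof. by exists 0 => _ [s _ <-]; apply: sumr_ge0. Qed.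

Let len_inf x : has_inf (chains x).
Proof.
split=> //; exists (\sum_(v <- [:: x]) f v); exists [:: x] => //=.
by rewrite big_seq1.
Qed.

Let len_le (s : seq G) : len (\prod_(v <- s) v)%g <= \sum_(v <- s) f v.
Proof. by apply: ge_inf => //; exists s. Qed.

Let len_ge0 x : 0 <= len x.
Proof.
apply: lb_le_inf; first by have [] := len_inf x.
by move=> _ [s _ <-]; apply: sumr_ge0.
Qed.

Let len_lef x : len x <= f x.
Proof. by have := len_le [:: x]; rewrite !big_seq1. Qed.

Let f_len x : f x <= 2 * len x.
Proof.
rewrite -ler_pdivrMl //; apply: lb_le_inf; first by have [] := len_inf x.
move=> _ [s /= <- <-]; rewrite ler_pdivrMl //.
exact: (chain_le f_ge0 f1 fM).
Qed.

Let lenM x y : len (x * y)%g <= len x + len y.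
Proof.
apply/ler_addgt0Pr => e e0; have e2 : 0 < e / 2 by lra.
have [_ [s sx <-] hs] := inf_adherent e2 (len_inf x).
have [_ [t ty <-] ht] := inf_adherent e2 (len_inf y).
have := len_le (s ++ t); rewrite !big_cat /= sx ty => h.
by move: hs ht h; rewrite -/(len x) -/(len y); lra.
Qed.

Let prodV (s : seq G) :
  ((\prod_(v <- s) v)^-1 = \prod_(v <- [seq v^-1 | v <- rev s]) v)%g.
Proof.
elim: s => [|v s IH]; first by rewrite !big_nil invg1.
by rewrite rev_cons map_rcons -cats1 big_cat big_seq1 big_cons invgM IH.
Qed.

Let lenV x : len (x^-1)%g = len x.
Proof.
have h y : len (y^-1)%g <= len y.
  apply: lb_le_inf; first by have [] := len_inf y.
  move=> _ [s /= <- <-]; rewrite prodV; apply: le_trans (len_le _) _.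
  rewrite big_map (perm_big s) ?perm_rev //=.
  by apply: ler_sum => v _; rewrite fV.
by apply/eqP; rewrite eq_le h -{1}(invgK x) h.
Qed.

(** Small scales make [d] continuous. The second clause leads back from balls to scales, so that
    compact scales will make [d] proper. *)
Theorem birkhoff_kakutani : exists d : G -> G -> R, clip d /\
  forall r, exists i, forall x, d 1%g x <= r -> S i x.
Proof.
have l1 : len 1%g = 0.
  by apply/eqP; rewrite eq_le len_ge0 andbT; have := len_lef 1%g; rewrite f1.
exists (fun x y => len (x^-1 * y)%g); split.
  apply: left_invariant_clip.
  - split=> [x y _ _|x _|x y _ _|x y z _ _ _] //.
    + by rewrite mulVg.
    + by rewrite -lenV invgM invgK.
    + by have := lenM (x^-1 * y)%g (y^-1 * z)%g; rewrite mulgA mulgK.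
  - by move=> g x y; rewrite invgM -mulgA mulKg.
  - move=> e /exprz2_small[i ie]; apply: filterS (S_nbhs i) => x Six /=.
    rewrite invg1 mul1g; apply: le_lt_trans ie.
    by apply: le_trans (f_le Six).
(* By [f_len], [f x] is at most [2 * r]; the extra 1 gives the strict inequality that [f_lt] asks
   for. *)
move=> r; have [i hi] : exists i : int, 2 * r + 1 <= (2 : R) ^ i.
  exists (Posz (Num.bound (2 * r + 1))); apply: ltW.
  exact: upper_nthrootP.
exists i => x; rewrite invg1 mul1g => lr.
have := f_len x => h; have [|j jr Sj] := @f_lt x (2 * r + 1); first lra.
apply: scale_nested Sj; rewrite -(@ler_eXz2l R 2) ?ltr1n //.
by apply: ltW; exact: lt_le_trans hi.
Qed.

End birkhoff_kakutani.

(* Apply compactness to the filter of sets whose complement in K is small. *)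
Lemma compact_ideal (T : topologicalType) (K : set T) (P : set (set T)) :
  compact K -> P set0 -> (forall A B, A `<=` B -> P B -> P A) ->
  (forall A B, P A -> P B -> P (A `|` B)) ->
  (forall x, K x -> exists2 U, nbhs x U & P U) -> P K.
Proof.
move=> cK P0 Psub PU Ploc; apply: contrapT => nPK.
pose F : set_system T := [set B | P (K `\` B)].
have FF : ProperFilter F.
  apply: Build_ProperFilter; first by rewrite /F /= setD0.
  split.
  - by rewrite /F /= setDT.
  - by move=> A B FA FB; rewrite /F /= setDIr; exact: PU.
  - by move=> A B AB; rewrite /F /=; apply: Psub => x [Kx nBx]; split=> // /AB.
have [|x [Kx clx]] := cK F FF; first by rewrite /F /= setDv.
have [U Ux PUU] := Ploc x Kx.
have [|y [nUy Uy]] := clx (~` U) U _ Ux; last exact: nUy.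
by rewrite /F /= setDE setCK; apply: Psub PUU => y [].
Qed.

(** * Compact sets and neighbourhoods of the identity in a topological group *)

Lemma compactM (G : topologicalGroupType) (A B : set G) :
  compact A -> compact B -> compact [set (p.1 * p.2)%g | p in A `*` B].
Proof.
move=> cA cB; apply: continuous_compact (compact_setX cA cB).
by apply: continuous_subspaceT; exact: mulg_continuous.
Qed.

Lemma compactV (G : topologicalGroupType) (A : set G) :
  compact A -> compact [set (x^-1)%g | x in A].
Proof.
move=> cA; apply: continuous_compact cA.
by apply: continuous_subspaceT; exact: invg_continuous.
Qed.

Definition symmetric_hull (G : groupType) (A : set G) : set G :=
  A `|` [set (x^-1)%g | x in A].

Lemma symmetric_hullV (G : groupType) (A : set G) x :
  symmetric_hull A x -> symmetric_hull A (x^-1)%g.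
Proof.
by move=> [Ax|[y Ay <-]]; [right; exists x|left; rewrite invgK].
Qed.

Lemma compact_symmetric_hull (G : topologicalGroupType) (A : set G) :
  compact A -> compact (symmetric_hull A).
Proof. by move=> cA; apply: compactU => //; exact: compactV. Qed.

Lemma nbhs1_cube (G : topologicalGroupType) (U : set G) : nbhs (1%g : G) U ->
  exists V : set G, [/\ nbhs (1%g : G) V, forall x, V x -> V (x^-1)%g &
    forall x y z, V x -> V y -> V z -> U (x * y * z)%g].
Proof.
have sq (W : set G) : nbhs (1%g : G) W -> exists2 V : set G,
    nbhs (1%g : G) V & forall x y, V x -> V y -> W (x * y)%g.
  move=> nW; have : nbhs ((1%g, 1%g) : G * G)
      ((fun p : G * G => (p.1 * p.2)%g) @^-1` W).
    by apply: (@mulg_continuous _ (1%g, 1%g)); rewrite /= mulg1.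
  move=> [[A B] /= [nA nB] AB]; exists (A `&` B); first exact: filterI.
  by move=> x y [Ax _] [_ By]; exact: (AB (x, y)).
move=> nU; have [V1 nV1 V1U] := sq U nU; have [V2 nV2 V2V1] := sq V1 nV1.
have nV : nbhs (1%g : G) (V1 `&` V2) by exact: filterI.
exists ((V1 `&` V2) `&` [set x | (V1 `&` V2) (x^-1)%g]); split.
- apply: filterI => //; apply: (@invg_continuous _ 1%g).
  by rewrite invg1.
- by move=> x [Vx Vx']; split; rewrite /= ?invgK.
- move=> x y z [[_ V2x] _] [[_ V2y] _] [[V1z _] _].
  by apply: V1U => //; exact: V2V1.
Qed.

(** * Proper pseudometrics on locally compact, sigma-compact groups *)

Definition proper_pseudometric (R : realType) (G : topologicalGroupType)
    (d : G -> G -> R) :=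
  forall r, exists2 K : set G, compact K & forall x, d 1%g x <= r -> K x.

Lemma proper_clip (R : realType) (G : topologicalGroupType) :
  locally_compact [set: G] -> sigma_compact G ->
  exists2 d : G -> G -> R, clip d & proper_pseudometric d.
Proof.
move=> lcG [K [cK KT]].
have [U nU [cU _]] := lcG 1%g I.
have {}nU : nbhs (1%g : G) U.
  by apply: (@filterS _ (nbhs (1%g : G)) _ _ U _ nU) => x; apply.
(* Adjoining [K m] at each step makes the scales exhaust the group; the triple product gives the
   cube condition. *)
pose V := fix V n : set G := if n is m.+1 then
  [set (p.1 * p.2)%g | p in [set (p.1 * p.2)%g | p in V m `*` V m] `*` V m]
  `|` symmetric_hull (K m) else symmetric_hull U.
have cV n : compact (V n).
  elim: n => [|n IH]; first exact: compact_symmetric_hull.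
  by apply: compactU; [do 2!apply: compactM => //|
    exact: compact_symmetric_hull].
have VV n x : V n x -> V n (x^-1)%g.
  elim: n x => [|n IH] x; first exact: symmetric_hullV.
  case=> [[[_ z] /= [[[x1 y] /= [Vx1 Vy] <-] Vz] <-]|/symmetric_hullV];
    last by right.
  left; exists ((z^-1 * y^-1)%g, (x1^-1)%g); last by rewrite !invgM mulgA.
  by split; [exists (z^-1, y^-1)%g => //; split|]; exact: IH.
(* [next A] is a symmetric cube root of a neighbourhood [A] of the identity, and arbitrary for other
   sets. *)
have /choice[next nextP] : forall A : set G, exists B : set G,
    nbhs (1%g : G) A ->
    [/\ nbhs (1%g : G) B, forall x, B x -> B (x^-1)%g &
    forall x y z, B x -> B y -> B z -> A (x * y * z)%g].
  move=> A.
  have [/nbhs1_cube[B hB]|nA] := pselect (nbhs (1%g : G) A); first by exists B.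
  by exists A.
(* [W 0] sits at scale -1, so it must already be a cube root of [V 0]: hence [n.+1] iterations. *)
pose W n := iter n.+1 next (V 0).
have nV0 : nbhs (1%g : G) (V 0).
  by apply: (@filterS _ (nbhs (1%g : G)) _ U) => // x; left.
have nW n : nbhs (1%g : G) (W n).
  by elim: n => [|n /nextP[]//]; have [] := nextP _ nV0.
(* Compact sets at scales >= 1, neighbourhoods below V 0 at scales < 1. *)
pose S (i : int) : set G := match i with Posz n => V n | Negz n => W n end.
have V1 n : V n 1%g.
  elim: n => [|n IH]; first exact: nbhs_singleton.
  left; exists (1%g, 1%g); last by rewrite mulg1.
  by split=> //; exists (1%g, 1%g); rewrite ?mulg1.
have V3 n x y z : V n x -> V n y -> V n z -> V n.+1 (x * y * z)%g.
  move=> Vx Vy Vz; left; exists ((x * y)%g, z) => //.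
  by split=> //; exists (x, y).
have Vmono n x : V n x -> V n.+1 x.
  by move=> Vx; rewrite -(mulg1 x) -(mulg1 x); exact: V3.
have S_nbhs i : nbhs (1%g : G) (S i).
  by case: i => // n; elim: n => //= n IH; apply: filterS IH => x; exact: Vmono.
have SV i x : S i x -> S i (x^-1)%g.
  case: i => n /=; first exact: VV.
  by case: n => [|n]; [have [_ + _] := nextP _ nV0|
    have [_ + _] := nextP _ (nW n)]; apply.
have S3 i x y z : S i x -> S i y -> S i z -> S (i + 1) (x * y * z)%g.
  case: i => n; first by rewrite -PoszD addn1; exact: V3.
  case: n => [|n]; first by have [_ _] := nextP _ nV0; apply.
  have -> : Negz n.+1 + 1 = Negz n by lia.
  by have [_ _] := nextP _ (nW n); apply.
have [|d [cd pd]] := @birkhoff_kakutani R G S S_nbhs SV S3.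
  move=> x; have : [set: G] x by [].
  by rewrite -KT => -[n _ Kx]; exists n.+1; right; left.
exists d => // r; have [i hi] := pd r.
(* Scales of negative index need not be compact, so [i] is replaced by the larger [|i|]. *)
exists (S `|i|%N) => [|x /hi]; first exact: cV.
by apply: (scale_nested S_nbhs S3); rewrite abszE ler_norm.
Qed.

(** * Basic properties and constructions of continuous left-invariant pseudometrics *)

Lemma bounded_coarseP (R : realType) (X : Type) (d : X -> X -> R)
    (E : set (X * X)) :
  bounded_coarse d E <-> exists M, forall x y, E (x, y) -> d x y <= M.
Proof.
split=> [[M hM]|[M hM]]; exists M.
  by move=> x y Exy; apply: hM; exists (x, y).
by move=> _ [[x y] Exy <-]; exact: hM.
Qed.

Section clip_theory.
Context (R : realType) (G : topologicalGroupType) (d : G -> G -> R).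
Hypothesis cd : clip d.

Lemma clip_ge0 x y : 0 <= d x y.
Proof. exact: pseudometric_ge0 (clip_pseudometric cd) _ _ I I. Qed.

Lemma clip_refl x : d x x = 0.
Proof. exact: pseudometric_refl (clip_pseudometric cd) _ I. Qed.

Lemma clip_sym x y : d x y = d y x.
Proof. exact: pseudometric_sym (clip_pseudometric cd) _ _ I I. Qed.

Lemma clip_triangle x y z : d x z <= d x y + d y z.
Proof. exact: pseudometric_triangle (clip_pseudometric cd) _ _ _ I I I. Qed.

Lemma clip_mulV x y : d x y = d 1%g (x^-1 * y)%g.
Proof. by rewrite -(clip_left_invariant cd (x^-1)%g) mulVg. Qed.

Lemma clip_ball x e : 0 < e -> nbhs x [set y | d x y < e].
Proof.
move=> e0; have cx : (fun y => d x y) @ x --> d x x.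
  have c1 : (fun=> x) @ x --> x by exact: cvg_cst.
  exact: (cvg_comp _ _ (cvg_pair c1 (@cvg_id _ (nbhs x)))
    (@clip_continuous _ _ _ cd (x, x))).
move/cvgrPdist_lt : cx => /(_ e e0); rewrite clip_refl.
apply: filterS => y /=; rewrite sub0r normrN; apply: le_lt_trans.
exact: ler_norm.
Qed.

(** Balls of radius 1 are neighbourhoods on which the distance to the identity is bounded, and
    bounded sets form an ideal. *)
Lemma clip_compact (K : set G) : compact K ->
  exists M, forall x, K x -> d 1%g x <= M.
Proof.
move=> cK; apply: (compact_ideal
  (P := fun A => exists M, forall x, A x -> d 1%g x <= M) cK).
- by exists 0.
- by move=> A B AB [M hM]; exists M => x /AB; exact: hM.
- move=> A B [M hM] [N hN]; exists (Num.max M N) => x.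
  by rewrite le_max => -[/hM ->//|/hN ->]; rewrite orbT.
- move=> x _; exists [set y | d x y < 1]; first exact: clip_ball.
  exists (d 1%g x + 1) => y /= xy.
  by have := clip_triangle 1%g x y; lra.
Qed.

End clip_theory.

Lemma clip_comp (R : realType) (G K : topologicalGroupType) (phi : G -> K)
    (d : K -> K -> R) :
  continuous phi -> {morph phi : x y / (x * y)%g} -> clip d ->
  clip (fun x y => d (phi x) (phi y)).
Proof.
move=> cphi phiM cd; apply: left_invariant_clip.
- split=> [x y _ _|x _|x y _ _|x y z _ _ _].
  + exact: clip_ge0.
  + exact: clip_refl.
  + exact: clip_sym.
  + exact: clip_triangle.
- by move=> g x y; rewrite !phiM (clip_left_invariant cd).
- by move=> e e0; exact: (cphi 1%g _ (clip_ball cd _ e0)).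
Qed.

Lemma clip_sum (R : realType) (G : topologicalGroupType)
    (D : nat -> G -> G -> R) (m : nat) :
  (forall n, clip (D n)) -> clip (fun x y => \sum_(n < m) D n x y).
Proof.
move=> cD; apply: left_invariant_clip.
- split=> [x y _ _|x _|x y _ _|x y z _ _ _].
  + by apply: sumr_ge0 => n _; exact: clip_ge0.
  + by apply: big1 => n _; exact: clip_refl.
  + by apply: eq_bigr => n _; exact: clip_sym.
  + by rewrite -big_split; apply: ler_sum => n _; exact: clip_triangle.
- by move=> g x y; apply: eq_bigr => n _; rewrite (clip_left_invariant (cD n)).
- elim: m => [|m IH] e e0.
    by apply: filterS filterT => x _; rewrite /= big_ord0.
  have e2 : 0 < e / 2 by lra.
  apply: filterS (filterI (IH _ e2) (clip_ball (cD m) 1%g e2)) => x /= [h1 h2].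
  by rewrite big_ord_recr /=; lra.
Qed.

(** * Hausdorff pseudometrics and coarse structures on the quotient group *)

Section quotient.
Context (R : realType) (G : topologicalGroupType) (H : set G).
Context (nH : normal_subgroup H).
Local Notation Q := (quotient_group nH).
Local Notation pi := (quotient_pi nH).

Lemma quotient_ind (P : Q -> Prop) : (forall g, P (pi g)) -> forall q, P q.
Proof. by move=> h q; rewrite -(quotient_reprK q). Qed.

Section hausdorff.
Context (d : G -> G -> R) (cd : clip d).
Let dist g f := [set d (h * g)%g f | h in H].

Let dist_inf g f : has_inf (dist g f).
Proof.
split; first by exists (d (1 * g)%g f); exists 1%g => //; exact: (normal1 nH).
by exists 0 => _ [h _ <-]; exact: clip_ge0.
Qed.

Lemma coset_hausdorff_le g f h : H h ->
  coset_hausdorff d (pi g) (pi f) <= d (h * g)%g f.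
Proof.
move=> Hh; rewrite (coset_hausdorffE _ _ _ cd); apply: ge_inf.
  by have [] := dist_inf g f.
by exists h.
Qed.

Lemma coset_hausdorff_approx g f r : coset_hausdorff d (pi g) (pi f) < r ->
  exists2 h, H h & d (h * g)%g f < r.
Proof.
rewrite (coset_hausdorffE _ _ _ cd) -subr_gt0 => e0.
have [_ [h Hh <-]] := inf_adherent e0 (dist_inf g f).
by rewrite addrC subrK; exists h.
Qed.

Lemma coset_hausdorff_ge g f c : (forall h, H h -> c <= d (h * g)%g f) ->
  c <= coset_hausdorff d (pi g) (pi f).
Proof.
move=> hc; rewrite (coset_hausdorffE _ _ _ cd); apply: lb_le_inf.
  by have [] := dist_inf g f.
by move=> _ [h Hh <-]; exact: hc.
Qed.

Lemma coset_hausdorff_clip : clip (coset_hausdorff d : Q -> Q -> R).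
Proof.
have ge0 g f : 0 <= coset_hausdorff d (pi g) (pi f).
  by apply: coset_hausdorff_ge => h _; exact: clip_ge0.
have H1 := normal1 nH.
have sym g f : coset_hausdorff d (pi g) (pi f) <=
    coset_hausdorff d (pi f) (pi g).
  apply: coset_hausdorff_ge => h Hh.
  apply: le_trans (coset_hausdorff_le _ _ (normalV nH Hh)) _.
  by rewrite -(clip_left_invariant cd h) mulgA mulgV mul1g (clip_sym cd).
apply: left_invariant_clip.
- split=> [|p _||].
  + by move=> + + _ _; apply: quotient_ind => g; apply: quotient_ind => f.
  + move: p; apply: quotient_ind => g; apply/eqP; rewrite eq_le ge0 andbT.
    by apply: le_trans (coset_hausdorff_le _ _ H1) _; rewrite mul1g clip_refl.
  + move=> + + _ _; apply: quotient_ind => g; apply: quotient_ind => f.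
    by apply/eqP; rewrite eq_le !sym.
  + move=> + + + _ _ _; apply: quotient_ind => g.
    apply: quotient_ind => f; apply: quotient_ind => k.
    apply/ler_addgt0Pr => e e0.
    have [|a Ha da] := @coset_hausdorff_approx g f
      (coset_hausdorff d (pi g) (pi f) + e / 2); first lra.
    have [|b Hb db] := @coset_hausdorff_approx f k
      (coset_hausdorff d (pi f) (pi k) + e / 2); first lra.
    (* The near-optimal translates combine: multiplying the first estimate on the left by [b] keeps
       its distance and makes it end at [b * f]. *)
    apply: le_trans (coset_hausdorff_le _ _ (normalM nH Hb Ha)) _.
    have := clip_triangle cd (b * a * g)%g (b * f)%g k.
    by rewrite -mulgA (clip_left_invariant cd); lra.
(* Normality moves [a] past [h] by conjugation. The reverse inequality is [sub] for the inverse of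
   [a]. *)
- have sub a g f : coset_hausdorff d (pi a * pi g)%g (pi a * pi f)%g <=
      coset_hausdorff d (pi g) (pi f).
    rewrite -!quotient_piM; apply: coset_hausdorff_ge => h Hh.
    have Ha : H (a * h * a^-1)%g.
      by have := normalJ nH (a^-1)%g Hh; rewrite invgK.
    apply: le_trans (coset_hausdorff_le _ _ Ha) _.
    by rewrite mulgA mulgVK -mulgA (clip_left_invariant cd).
  apply: quotient_ind => a; apply: quotient_ind => g; apply: quotient_ind => f.
  apply/eqP; rewrite eq_le sub /=.
  have := sub (a^-1)%g (a * g)%g (a * f)%g.
  by rewrite -!quotient_piM !mulKg.
(* The coset distance is at most [d 1 g], and [pi] is open, so the image of a small ball is a
   neighbourhood. *)
- move=> e e0; have n1 := clip_ball cd 1%g e0.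
  move: n1; rewrite nbhsE => -[W [oW W1] WA].
  apply: (@filterS _ _ _ (pi @` W)).
    move=> _ [g /WA /= dg <-]; apply: le_lt_trans dg.
    by apply: le_trans (coset_hausdorff_le _ _ H1) _; rewrite mul1g.
  by apply: open_nbhs_nbhs; split; [exact: quotient_pi_open|exists 1%g].
Qed.

End hausdorff.

(** Hausdorff pseudometrics are themselves continuous and left-invariant on the quotient.
    Conversely, such a pseudometric on the quotient is dominated by the Hausdorff pseudometric of
    its pullback along [pi]. *)
Lemma left_coarse_quotient : left_coarse R Q = hausdorff_coarse R nH.
Proof.
apply/seteqP; split=> E EE d cd; first by apply: EE; exact: coset_hausdorff_clip.
have cpi : clip (fun x y => d (pi x) (pi y)).
  apply: clip_comp cd; first exact: quotient_pi_continuous.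
  exact: quotient_piM.
have /bounded_coarseP[M hM] := EE _ cpi; apply/bounded_coarseP; exists M.
apply: quotient_ind => g; apply: quotient_ind => f /hM; apply: le_trans.
apply: (coset_hausdorff_ge cpi) => h Hh /=.
suff -> : pi (h * g)%g = pi g by [].
by apply/quotient_piP; rewrite mulgK.
Qed.

(** By minimality of the pushforward it suffices that [pi] is controlled, which holds because
    pseudometrics pull back along [pi]. *)
Lemma quotient_coarse_sub : quotient_coarse R nH `<=` left_coarse R Q.
Proof.
have [_ _ least] := coarse_pushforward_least (left_coarse R G) pi.
apply: least; first exact: left_coarse_structure.
move=> A EA d cd.
have cpi : clip (fun x y => d (pi x) (pi y)).
  apply: clip_comp cd; first exact: quotient_pi_continuous.
  exact: quotient_piM.
have /bounded_coarseP[M hM] := EA _ cpi; apply/bounded_coarseP; exists M.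
by move=> _ _ [[x y] Axy [<- <-]]; exact: hM.
Qed.

End quotient.

(** * Coordinate pseudometrics on the product *)

Section product.
Context (R : realType) (G_ : nat -> topologicalGroupType).
Context (d : forall n, G_ n -> G_ n -> R).
Hypothesis d_clip : forall n, clip (@d n).
Hypothesis d_proper : forall n, proper_pseudometric (@d n).
Local Notation G := (prod_topology G_).

Definition coord_dist (n : nat) (x y : G) : R := d (x n) (y n).
Local Notation D := coord_dist.

Definition partial_dist (N : nat) (x y : G) : R := \sum_(n < N) D n x y.
Local Notation S := partial_dist.

Lemma coord_dist_clip n : clip (D n).
Proof.
by apply: (@clip_comp R G (G_ n) (fun x : G => x n)) => //; exact: proj_continuous.
Qed.

Lemma partial_dist_clip N : clip (S N).
Proof. by apply: clip_sum => n; exact: coord_dist_clip. Qed.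

Lemma coord_dist_le n N x y : (n < N)%N -> D n x y <= S N x y.
Proof.
move=> nN; rewrite /S (bigD1 (Ordinal nN)) //= lerDl.
by apply: sumr_ge0 => i _; exact: (clip_ge0 (coord_dist_clip i)).
Qed.

Lemma partial_dist_le m N x y : (m <= N)%N -> S m x y <= S N x y.
Proof.
move=> /subnKC <-; elim: (N - m)%N => [|k IH]; first by rewrite addn0.
rewrite addnS /S big_ord_recr /=; apply: le_trans IH _.
by rewrite lerDl; exact: (clip_ge0 (coord_dist_clip _)).
Qed.

(** Properness puts all elements [x^-1 * y] in a product of compact sets, on which every continuous
    left-invariant pseudometric is bounded. *)
Lemma prod_left_coarse (E : set (G * G)) :
  (forall n, bounded_coarse (D n) E) -> left_coarse R G E.
Proof.
move=> bE e ce.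
have K_ n : {K : set (G_ n) | compact K &
    forall x y, E (x, y) -> K ((x n)^-1 * y n)%g}.
  apply: cid2; have /bounded_coarseP[M hM] := bE n.
  have [K cK hK] := d_proper n M; exists K => // x y /hM; rewrite /D.
  by rewrite (clip_mulV (d_clip n)) => /hK.
have cK : compact [set f : G | forall n, s2val (K_ n) (f n)].
  exact: (tychonoff (fun n => s2valP (K_ n))).
have [M hM] := clip_compact ce cK.
apply/bounded_coarseP; exists M => x y Exy; rewrite (clip_mulV ce).
by apply: hM => n; exact: (s2valP' (K_ n)).
Qed.

(** Truncation is invisible to [S N] and brings a set that is bounded in its first [N] coordinates
    into a compact product. *)
Let trunc N (x : G) : G := fun n => if (n < N)%N then x n else 1%g.

Let truncE N x y : S N (trunc N x) (trunc N y) = S N x y.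
Proof. by apply: eq_bigr => n _; rewrite /D /trunc ltn_ord. Qed.

(** The truncations of [A] lie in a compact set, covered by finitely many [S N]-balls of radius 1.
    If [D m] were bounded on the part of [A] over each ball, it would be bounded on [A]; the 2 is
    twice the radius. *)
Lemma unbounded_small_diameter (A : set G) N m :
  (exists M, forall x, A x -> S N 1%g x <= M) ->
  ~ (exists M, forall x, A x -> D m 1%g x <= M) ->
  exists B, [/\ B `<=` A, ~ (exists M, forall x, B x -> D m 1%g x <= M) &
    forall x y, B x -> B y -> S N x y <= 2].
Proof.
move=> [M hM] unb; apply: contrapT => nB; apply: unb.
have K_ n : {K : set (G_ n) | compact K & forall x, A x -> K (trunc N x n)}.
  apply: cid2; rewrite /trunc; have [nN|nN] := ltnP n N; last first.
    by exists [set 1%g] => //; exact: compact_set1.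
  have [K cK hK] := d_proper n M; exists K => // x /hM h; apply: hK.
  exact: le_trans (coord_dist_le 1%g x nN) h.
have cK : compact [set f : G | forall n, s2val (K_ n) (f n)].
  exact: (tychonoff (fun n => s2valP (K_ n))).
suff [M' hM'] : exists M', forall x, A x ->
    (forall n, s2val (K_ n) (trunc N x n)) -> D m 1%g x <= M'.
  by exists M' => x Ax; apply: hM' => // n; exact: (s2valP' (K_ n)).
apply: (compact_ideal (P := fun C => exists M', forall x, A x -> C (trunc N x) ->
  D m 1%g x <= M') cK).
- by exists 0.
- by move=> B C BC [M' hM']; exists M' => x Ax /BC; exact: hM'.
- move=> B C [M1 h1] [M2 h2]; exists (Num.max M1 M2) => x Ax.
  by rewrite le_max => -[/h1 ->//|/h2 ->]; rewrite ?orbT.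
- move=> z _; exists [set y | S N z y < 1].
    exact: (clip_ball (partial_dist_clip N)).
  apply: contrapT => unb; apply: nB.
  exists (A `&` [set x | S N z (trunc N x) < 1]); split; first by move=> x [].
    by apply: contra_not unb => -[M' hM']; exists M' => x Ax zx; exact: hM'.
  move=> x y [_ /= zx] [_ /= zy]; rewrite -truncE.
  have := clip_triangle (partial_dist_clip N) (trunc N x) z (trunc N y).
  by rewrite (clip_sym (partial_dist_clip N) _ z); lra.
Qed.

(** * Metrisability on the subgroup and lifting from the quotient *)

Section subgroup.
Context (H : set G) (nH : normal_subgroup H).

(* Otherwise each N gives, by translating a set of small diameter to the
   identity, an a_N in H whose first N coordinates are small but whose distance
   to 1 in the metric of H exceeds N; the set of all a_N is then bounded in every
   coordinate yet unbounded in H. *)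
Lemma metrisable_finite_coords :
  metrisable_on R H (coarse_restrict (left_coarse R G) H) ->
  exists N, forall A : set G, A `<=` H ->
    (exists M, forall x, A x -> S N 1%g x <= M) ->
    forall m, exists M, forall x, A x -> D m 1%g x <= M.
Proof.
move=> [b [_ Eb]]; apply: contrapT => /forallNP nN.
have H1 := normal1 nH.
have /choice[a ha] : forall N, exists a,
    [/\ H a, S N 1%g a <= 2 & N%:R < b 1%g a].
  move=> N; apply: contrapT => na; apply: (nN N) => A AH bA m.
  apply: contrapT => /(unbounded_small_diameter bA)[B [BA unbB diamB]].
  apply: (unbB); have [[z Bz]|B0] := pselect (exists z, B z); last first.
    by exists 0 => x Bx; case: B0; exists x.
  have Hz y : B y -> H (z^-1 * y)%g.
    by move=> By; apply: (normalM nH); [apply: (normalV nH)|]; exact/AH/BA.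
  (* Without a suitable [a], the metric [b] is at most [N] on [Z], so [Z] belongs to the coarse
     structure and [D m] is bounded on it, hence on [B]. *)
  pose Z := [set (1%g : G, (z^-1 * y)%g) | y in B].
  have : coarse_restrict (left_coarse R G) H Z.
    rewrite Eb; split; last by move=> _ [y By <-]; split=> //; exact: Hz.
    apply/bounded_coarseP; exists N%:R => _ _ [y By [<- <-]].
    rewrite leNgt; apply/negP => h; apply: na; exists (z^-1 * y)%g.
    split=> //; first exact: Hz.
    by rewrite -(clip_mulV (partial_dist_clip N)); exact: diamB.
  move=> [/(_ _ (coord_dist_clip m))/bounded_coarseP[M hM] _].
  exists (D m 1%g z + M) => y By.
  apply: le_trans (clip_triangle (coord_dist_clip m) _ z _) _.
  rewrite lerD2l (clip_mulV (coord_dist_clip m) z).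
  by apply: hM; exists y.
pose E := [set (1%g : G, a N) | N in [set: nat]].
have : coarse_restrict (bounded_coarse b) H E.
  rewrite -Eb; split; last by move=> _ [N _ <-]; split=> //; have [] := ha N.
  apply: prod_left_coarse => n; apply/bounded_coarseP.
  have ge0 := clip_ge0 (coord_dist_clip n) 1%g.
  (* The 2 serves all [N > n], where [S N] controls coordinate [n]; the sum serves the finitely many
     [N <= n]. *)
  exists (2 + \sum_(N < n.+1) D n 1%g (a N)) => _ _ [N _ [<- <-]].
  have [nN'|Nn] := ltnP n N.
    have [_ h _] := ha N; apply: le_trans (coord_dist_le _ _ nN') _.
    by rewrite (le_trans h) // lerDl sumr_ge0.
  rewrite (bigD1 (Ordinal (n := n.+1) (m := N) Nn)) //= addrCA lerDl.
  by rewrite addr_ge0 // sumr_ge0.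
move=> [/bounded_coarseP[M hM] _].
have [_ _] := ha (Num.bound `|M|); apply/negP; rewrite -leNgt.
apply: le_trans (ltW (archi_boundP (normr_ge0 M))).
apply: le_trans (ler_norm M).
by apply: hM; exists (Num.bound `|M|).
Qed.

Lemma hausdorff_coarse_sub :
  metrisable_on R H (coarse_restrict (left_coarse R G) H) ->
  hausdorff_coarse R nH `<=` quotient_coarse R nH.
Proof.
move=> /metrisable_finite_coords[N hN] E EE.
have bnd m : exists M, forall p q, E (p, q) ->
    exists h, H h /\ S m (h * repr p)%g (repr q) <= M.
  have /bounded_coarseP[M hM] := EE _ (partial_dist_clip m).
  (* The infimum over [H] need not be attained, hence the extra 1. *)
  exists (M + 1) => p q /hM pqM.
  have [|h Hh hlt] := coset_hausdorff_approx (nH := nH) (partial_dist_clip m)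
      (g := repr p) (f := repr q) (r := M + 1).
    by rewrite !quotient_reprK; lra.
  by exists h; split=> //; exact: ltW.
have [M hM] := bnd N.
(* This choice looks only at the first [N] coordinates and is fixed before any [m] is given. *)
have /choice[h hh] : forall pq : quotient_group nH * quotient_group nH,
    exists h, E pq -> H h /\ S N (h * repr pq.1)%g (repr pq.2) <= M.
  move=> [p q]; have [/hM[h ?]|nE] := pselect (E (p, q)); first by exists h.
  by exists 1%g.
pose A := [set ((h pq * repr pq.1)%g, repr pq.2) | pq in E].
have [cs push _] := coarse_pushforward_least (left_coarse R G) (quotient_pi nH).
have EA : left_coarse R G A.
  apply: prod_left_coarse => m.
  (* With this many coordinates the partial sum dominates both [S N] and [D m]. *)
  have [M' hM'] := bnd (N + m.+1)%N.
  pose B := [set x | exists pq k, [/\ E pq, H k,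
    S (N + m.+1) (k * repr pq.1)%g (repr pq.2) <= M' &
    x = ((h pq * repr pq.1)^-1 * (k * repr pq.1))%g]].
  have [||M2 hM2] := hN B _ _ m.
  - move=> _ [pq [k [/hh[Hh _] Hk _ ->]]].
    rewrite invgM -mulgA (mulgA (h pq)^-1%g) mulgA.
    by apply: (normalJ nH); apply: (normalM nH) => //; exact: (normalV nH).
  - exists (M + M') => _ [pq [k [/hh[_ hle] Hk kle ->]]].
    rewrite -(clip_mulV (partial_dist_clip N)).
    apply: le_trans (clip_triangle (partial_dist_clip N) _ (repr pq.2) _) _.
    apply: lerD => //; rewrite (clip_sym (partial_dist_clip N)).
    by apply: le_trans kle; apply: partial_dist_le; rewrite leq_addr.
  apply/bounded_coarseP; exists (M2 + M') => _ _ [[p q] Epq [<- <-]] /=.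
  have [k [Hk kle]] := hM' p q Epq.
  apply: le_trans (clip_triangle (coord_dist_clip m) _ (k * repr p)%g _) _.
  apply: lerD; last first.
    by apply: le_trans kle; apply: coord_dist_le; rewrite leq_addl.
  rewrite (clip_mulV (coord_dist_clip m)); apply: hM2.
  by exists (p, q), k.
(* The image of [A] under [pi] contains [E], since left multiplication by an element of [H] does not
   change the coset. *)
apply: (coarse_sub cs) (push A EA) => -[p q] Epq /=.
exists ((h (p, q) * repr p)%g, repr q); first by exists (p, q).
rewrite /= quotient_reprK; congr (_, _).
rewrite -[RHS](quotient_reprK (nH := nH)); apply/quotient_piP.
by rewrite mulgK; have [] := hh _ Epq.
Qed.

End subgroup.
End product.

Theorem theorem10 (R : realType) (G_ : nat -> topologicalGroupType)
    (G_lc : forall n : nat, locally_compact [set: G_ n])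
    (G_sc : forall n : nat, sigma_compact (G_ n))
    (H : set (prod_topology G_)) (H_normal : normal_subgroup H)
    (H_closed : closed H)
    (H_metrisable : metrisable_on R H
       (coarse_restrict (left_coarse R (prod_topology G_)) H)) :
  quotient_coarse R H_normal = left_coarse R (quotient_group H_normal) /\
  left_coarse R (quotient_group H_normal) = hausdorff_coarse R H_normal.
Proof.
split; last exact: left_coarse_quotient.
apply/seteqP; split; first exact: quotient_coarse_sub.
have d_ n := cid2 (proper_clip R (G_lc n) (G_sc n)).
rewrite left_coarse_quotient.
exact: (hausdorff_coarse_sub (fun n => s2valP (d_ n)) (fun n => s2valP' (d_ n))).
Qed.
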